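(* If $X$ is a co-existentially closed continuum, then $C(X)$ is approximately algebraically closed.
   Context: A continuum is a connected compact Hausdorff space. $C(X)$ denotes the C*-algebra of continuous complex-valued functions on $X$. $T_{\mathrm{conn}}$ denotes a theory of continuous first-order logic in the language of unital C*-algebras whose models are exactly the C*-algebras isomorphic to $C(X)$ for some continuum $X$. A model $M \models T_{\mathrm{conn}}$ is existentially closed if for every $N \models T_{\mathrm{conn}}$ with $M \subseteq N$, every quantifier-free formula $\phi(\overline{x},\overline{y})$ and every tuple $\overline{b}$ from $M$, $(\inf_{\overline{x}}\phi(\overline{x},\overline{b}))^M = (\inf_{\overline{x}}\phi(\overline{x},\overline{b}))^N$. A continuum $X$ is co-existentially closed if $C(X)$ is an existentially closed model of $T_{\mathrm{conn}}$. A C*-algebra $A$ is approximately algebraically closed if for every $n>0$, every $a_0,\ldots,a_{n-1} \in A$ and every $\epsilon>0$ there is $f \in A$ with $\|a_0 + a_1 f + \cdots + a_{n-1}f^{n-1} + f^n\| < \epsilon$. *)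

(* Defs.v *)
From HB Require Import structures.
From mathcomp Require Import all_boot all_order all_algebra.
From mathcomp Require Import all_classical all_reals ereal topology normedtype.
From mathcomp Require Import complex ring.
Set Implicit Arguments.
Unset Strict Implicit.
Unset Printing Implicit Defensive.
Import Order.TTheory GRing.Theory Num.Theory.
Import numFieldNormedType.Exports.
Local Open Scope classical_set_scope.
Local Open Scope ring_scope.
Local Open Scope complex_scope.
Import ComplexField.Normc.

(* [R[i]] receives the topology and norm that the library puts on the regular
   module [R[i]^o]; norms are elements of [R[i]], which are real. *)
HB.instance Definition _ (R : realType) := NormedModule.copy R[i] R[i]^o.

Section Complex.
Context {R : realType}.
Implicit Types (z w : R[i]).

Lemma normr_normc z : `|z| = (normc z)%:C.
Proof. by []. Qed.

Lemma normc_ge0 z : 0 <= normc z.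
Proof. by rewrite -lecR; exact: (normr_ge0 z). Qed.

Lemma normc_conj z : normc z^* = normc z.
Proof. by apply: complexI; exact: (normcJ z). Qed.

Lemma gt0_RRe (e : R[i]) : 0 < e -> e = (complex.Re e)%:C.
Proof. by move=> e0; rewrite RRe_real// gtr0_real. Qed.

Lemma Re_continuous : continuous (@complex.Re R : R[i] -> R).
Proof.
move=> z; apply/(@cvgrPdist_lt _ _ _ _ (nbhs_filter z)) => e e0.
have e0' : 0 < e%:C by rewrite ltcR.
apply: filterS (nbhsx_ballx z _ e0') => w; rewrite -ball_normE/= -ltcR.
apply: le_lt_trans.
by rewrite -raddfB/=; exact: normc_ge_Re.
Qed.

Lemma normc_continuous : continuous (@normc R : R[i] -> R).
Proof.
move=> z; apply/(@cvgrPdist_lt _ _ _ _ (nbhs_filter z)) => e e0.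
have e0' : 0 < e%:C by rewrite ltcR.
apply: filterS (nbhsx_ballx z _ e0') => w; rewrite -ball_normE/= ltcR.
apply: le_lt_trans; rewrite ler_distl; apply/andP; split.
  rewrite lerBlDr -[X in normc X](subrK z w) (le_trans (le_normcD _ _))//.
  by rewrite addrC lerD2l -normcN opprB.
by rewrite -[X in normc X <= _](subrK w z) (le_trans (le_normcD _ _))// addrC.
Qed.

Lemma conjc_continuous : continuous (@conjc R).
Proof.
move=> z; apply/(@cvgrPdist_lt _ _ _ _ (nbhs_filter z)) => e e0.
apply: filterS (nbhsx_ballx z _ e0) => w.
by rewrite -ball_normE/= -rmorphB/= normcJ.
Qed.

Lemma normc_i : `|'i%C : R[i]| = 1.
Proof. by rewrite normc_def/= expr0n/= add0r expr1n sqrtr1. Qed.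

Lemma normc_le_ReIm z : `|z| <= (`|complex.Re z| + `|complex.Im z|)%:C.
Proof.
rewrite [in leLHS](complexE z) rmorphD/= (le_trans (ler_normD _ _))//.
rewrite normrM normc_i mul1r !normc_def/= !expr0n/= !addr0 !sqrtr_sqr.
by rewrite -!rmorphD lecR.
Qed.

Lemma complex_complete (F : set_system R[i]) :
  ProperFilter F -> cauchy F -> cvg F.
Proof.
move=> FF /cauchyP Fc.
have cR (h : {additive R[i] -> R}) : (forall z, `|h z|%:C <= `|z|) ->
    cvg (h @ F).
  move=> hle; apply: cauchy_cvg; apply/cauchyP => e e0.
  have e0' : 0 < e%:C by rewrite ltcR.
  have [z Fz] := Fc _ e0'; exists (h z).
  change (F (h @^-1` ball (h z) e)).
  apply: filterS Fz => w; rewrite -!ball_normE/= => zw.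
  rewrite -ltcR; by rewrite -(raddfB h); exact: le_lt_trans zw.
have /cvg_ex[a Fa] : cvg ((@complex.Re R : Rcomplex R -> R) @ F).
  by apply: cR => z; exact: normc_ge_Re.
have /cvg_ex[b Fb] : cvg ((@complex.Im R : Rcomplex R -> R) @ F).
  apply: cR => z; rewrite -normrN -ReiNIm.
  by apply: le_trans (normc_ge_Re _) _; rewrite normrM normc_i mulr1.
apply/cvg_ex; exists (a +i* b).
apply/cvgrPdist_lt => e e0; rewrite (gt0_RRe e0).
have e0' : 0 < complex.Re e / 2 by rewrite divr_gt0// -ltcR -gt0_RRe.
move/cvgrPdist_lt/(_ _ e0') : Fa => Fa; move/cvgrPdist_lt/(_ _ e0') : Fb => Fb.
near=> z; apply: le_lt_trans (normc_le_ReIm _) _; rewrite ltcR !raddfB/=.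
by rewrite [ltRHS]splitr ltrD//; near: z.
Unshelve. all: by end_near. Qed.

End Complex.

HB.instance Definition _ (R : realType) :=
  Uniform_isComplete.Build R[i] (@complex_complete R).

(* Unital C*-algebras. The norm is a field of the mixin because the library
   cannot join its rings with its normed modules: HB rejects the join. *)
HB.mixin Record isCStarAlgebra (R : realType) A & GRing.Algebra R[i] A := {
  star : A -> A;
  cnorm : A -> R;
  starK : involutive star;
  starD : {morph star : a b / a + b};
  starZ : forall (z : R[i]) a, star (z *: a) = z^* *: star a;
  starM : forall a b, star (a * b) = star b * star a;
  cnormD : forall a b, cnorm (a + b) <= cnorm a + cnorm b;
  cnormZ : forall (z : R[i]) a, cnorm (z *: a) = normc z * cnorm a;
  cnorm_eq0 : forall a, cnorm a = 0 -> a = 0;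
  cnormM : forall a b, cnorm (a * b) <= cnorm a * cnorm b;
  cnorm_star : forall a, cnorm (star a * a) = cnorm a ^+ 2;
  cnorm_complete : forall u : nat -> A,
    (forall e, 0 < e -> exists N : nat, forall m n : nat,
       (N <= m)%N -> (N <= n)%N -> cnorm (u m - u n) < e) ->
    exists l : A, forall e, 0 < e -> exists N : nat, forall n : nat,
       (N <= n)%N -> cnorm (u n - l) < e
}.

#[short(type="cstarAlgType")]
HB.structure Definition CStarAlgebra (R : realType) :=
  {A of GRing.Algebra R[i] A & isCStarAlgebra R A}.

(* Connected spaces are nonempty here, unlike with the library's [connected];
   this is what makes 1 <> 0 in C(X). *)
HB.mixin Record isContinuum X & Topological X := {
  continuum_nonempty : [set: X] !=set0;
  continuum_hausdorff : hausdorff_space X;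
  continuum_compact : compact [set: X];
  continuum_connected : connected [set: X]
}.

#[short(type="continuumType")]
HB.structure Definition Continuum := {X of Topological X & isContinuum X}.

(* C(X) *)
Definition cfun (R : realType) (X : continuumType) := continuousType X R[i].

HB.instance Definition _ (R : realType) (X : continuumType) :=
  Choice.on (cfun R X).

Section ContinuousFunctions.
Context {R : realType} {X : continuumType}.
Implicit Types (f g h : cfun R X) (z : R[i]).

Lemma cfunP f g : f =1 g -> f = g.
Proof. by move/continuousEP. Qed.

Fact cfun_add_subproof f g : continuous (fun x => f x + g x).
Proof. by move=> x; apply: cvgD; exact: cts_fun. Qed.
Fact cfun_opp_subproof f : continuous (fun x => - f x).
Proof. by move=> x; apply: cvgN; exact: cts_fun. Qed.
Fact cfun_mul_subproof f g : continuous (fun x => f x * g x).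
Proof. by move=> x; apply: cvgM; exact: cts_fun. Qed.
Fact cfun_scale_subproof z f : continuous (fun x => z * f x).
Proof. by move=> x; apply: cvgM; [exact: cvg_cst|exact: cts_fun]. Qed.
Fact cfun_star_subproof f : continuous (fun x => (f x)^*).
Proof.
by move=> x; apply: continuous_comp; [exact: cts_fun|exact: conjc_continuous].
Qed.
Fact cfun_cst_subproof z : continuous (fun _ : X => z).
Proof. by move=> x; exact: cvg_cst. Qed.

Definition cfun_add f g : cfun R X := mkcts (@cfun_add_subproof f g).
Definition cfun_opp f : cfun R X := mkcts (@cfun_opp_subproof f).
Definition cfun_mul f g : cfun R X := mkcts (@cfun_mul_subproof f g).
Definition cfun_scale z f : cfun R X := mkcts (@cfun_scale_subproof z f).
Definition cfun_star f : cfun R X := mkcts (@cfun_star_subproof f).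
Definition cfun_cst z : cfun R X := mkcts (@cfun_cst_subproof z).

Fact cfun_addA : associative cfun_add.
Proof. by move=> f g h; apply: cfunP => x /=; exact: addrA. Qed.
Fact cfun_addC : commutative cfun_add.
Proof. by move=> f g; apply: cfunP => x /=; exact: addrC. Qed.
Fact cfun_add0 : left_id (cfun_cst 0) cfun_add.
Proof. by move=> f; apply: cfunP => x /=; exact: add0r. Qed.
Fact cfun_addN : left_inverse (cfun_cst 0) cfun_opp cfun_add.
Proof. by move=> f; apply: cfunP => x /=; exact: addNr. Qed.
HB.instance Definition _ := GRing.isZmodule.Build (cfun R X)
  cfun_addA cfun_addC cfun_add0 cfun_addN.

Fact cfun_mulA : associative cfun_mul.
Proof. by move=> f g h; apply: cfunP => x /=; exact: mulrA. Qed.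
Fact cfun_mulC : commutative cfun_mul.
Proof. by move=> f g; apply: cfunP => x /=; exact: mulrC. Qed.
Fact cfun_mul1 : left_id (cfun_cst 1) cfun_mul.
Proof. by move=> f; apply: cfunP => x /=; exact: mul1r. Qed.
Fact cfun_mulDl : left_distributive cfun_mul cfun_add.
Proof. by move=> f g h; apply: cfunP => x /=; exact: mulrDl. Qed.
Fact cfun_1neq0 : cfun_cst 1 != 0.
Proof.
have [x _] := @continuum_nonempty X.
apply/eqP => /(congr1 (fun f : cfun R X => f x)) h.
have /eqP : (1 : R[i]) = 0 := h.
by rewrite oner_eq0.
Qed.
HB.instance Definition _ := GRing.Zmodule_isComNzRing.Build (cfun R X)
  cfun_mulA cfun_mulC cfun_mul1 cfun_mulDl cfun_1neq0.

Fact cfun_scaleA z w f : cfun_scale z (cfun_scale w f) = cfun_scale (z * w) f.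
Proof. by apply: cfunP => x /=; exact: mulrA. Qed.
Fact cfun_scale1 : left_id 1 cfun_scale.
Proof. by move=> f; apply: cfunP => x /=; exact: mul1r. Qed.
Fact cfun_scaleDr : right_distributive cfun_scale +%R.
Proof. by move=> z f g; apply: cfunP => x /=; exact: mulrDr. Qed.
Fact cfun_scaleDl f : {morph cfun_scale^~ f : z w / z + w}.
Proof. by move=> z w; apply: cfunP => x /=; exact: mulrDl. Qed.
HB.instance Definition _ := GRing.Zmodule_isLmodule.Build R[i] (cfun R X)
  cfun_scaleA cfun_scale1 cfun_scaleDr cfun_scaleDl.

Fact cfun_scaleAl z f g : z *: (f * g) = (z *: f) * g.
Proof. by apply: cfunP => x /=; exact: mulrA. Qed.
HB.instance Definition _ := GRing.Lmodule_isLalgebra.Build R[i] (cfun R X)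
  cfun_scaleAl.
HB.instance Definition _ := GRing.Lalgebra_isComAlgebra.Build R[i] (cfun R X).

Lemma cfun0E x : (0 : cfun R X) x = 0. Proof. by []. Qed.
Lemma cfun1E x : (1 : cfun R X) x = 1. Proof. by []. Qed.
Lemma cfunDE f g x : (f + g) x = f x + g x. Proof. by []. Qed.
Lemma cfunNE f x : (- f) x = - f x. Proof. by []. Qed.
Lemma cfunME f g x : (f * g) x = f x * g x. Proof. by []. Qed.
Lemma cfunZE z f x : (z *: f) x = z * f x. Proof. by []. Qed.

Definition cfun_norm f : R := sup [set normc (f x) | x in [set: X]].

Fact cfun_has_sup f : has_sup [set normc (f x) | x in [set: X]].
Proof.
split; first by have [x _] := @continuum_nonempty X; exists (normc (f x)), x.
have cN : continuous (fun x => normc (f x)).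
  move=> x; apply: (@continuous_comp _ _ _ f (@normc R)); first exact: cts_fun.
  exact: normc_continuous.
have /compact_bounded[M [_ /(_ (M + 1))]] :
    compact [set normc (f x) | x in [set: X]].
  apply: continuous_compact; last exact: continuum_compact.
  exact: continuous_subspaceT.
rewrite ltrDl ltr01 => /(_ erefl) hM; exists (M + 1) => _ [x _ <-].
by apply: le_trans (hM _ _); [exact: ler_norm|exists x].
Qed.

Lemma cfun_norm_ge f x : normc (f x) <= cfun_norm f.
Proof. by apply: (sup_upper_bound (cfun_has_sup f)); exists x. Qed.

Lemma cfun_norm_le f (c : R) :
  (forall x, normc (f x) <= c) -> cfun_norm f <= c.
Proof.
move=> fc; apply: ge_sup; first by case: (cfun_has_sup f).
by move=> _ [x _ <-].
Qed.

Fact cfun_normD f g : cfun_norm (f + g) <= cfun_norm f + cfun_norm g.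
Proof.
apply: cfun_norm_le => x; rewrite cfunDE (le_trans (le_normcD _ _))//.
by rewrite lerD// cfun_norm_ge.
Qed.

Fact cfun_norm_ge0 f : 0 <= cfun_norm f.
Proof.
have [x _] := @continuum_nonempty X.
exact: le_trans (normc_ge0 _) (cfun_norm_ge f x).
Qed.

Fact cfun_normZ z f : cfun_norm (z *: f) = normc z * cfun_norm f.
Proof.
apply/eqP; rewrite eq_le; apply/andP; split.
  apply: cfun_norm_le => x.
  by rewrite cfunZE normcM ler_wpM2l ?normc_ge0// cfun_norm_ge.
have [->|z0] := eqVneq z 0; first by rewrite normc0 mul0r cfun_norm_ge0.
have {}z0 : 0 < normc z.
  rewrite lt_def normc_ge0 andbT.
  by apply: contra z0 => /eqP /eq0_normc ->.
rewrite -ler_pdivlMl//; apply: cfun_norm_le => x.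
by rewrite ler_pdivlMl// -normcM -cfunZE cfun_norm_ge.
Qed.

Fact cfun_norm_eq0 f : cfun_norm f = 0 -> f = 0.
Proof.
move=> f0; apply: cfunP => x; apply: eq0_normc; apply/eqP.
by rewrite eq_le normc_ge0 -f0 cfun_norm_ge.
Qed.

Fact cfun_complete (u : nat -> cfun R X) :
  (forall e, 0 < e -> exists N : nat, forall m n : nat,
     (N <= m)%N -> (N <= n)%N -> cfun_norm (u m - u n) < e) ->
  exists l : cfun R X, forall e, 0 < e -> exists N : nat, forall n : nat,
     (N <= n)%N -> cfun_norm (u n - l) < e.
Proof.
move=> uc.
have ux x : cvg ((fun n => u n x : R[i]) @ \oo).
  apply: cauchy_cvg; apply/cauchyP => e e0; rewrite (gt0_RRe e0).
  have [|N uN] := uc (complex.Re e); first by rewrite -ltcR -gt0_RRe.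
  exists (u N x); exists N => // n /= Nn; rewrite -ball_normE/= normr_normc ltcR.
  by apply: le_lt_trans (uN N n _ _) => //; exact: (cfun_norm_ge (u N - u n)).
pose g x : R[i] := lim ((fun n => u n x : R[i]) @ \oo).
have ug (e : R) : 0 < e -> exists N : nat, forall n x, (N <= n)%N ->
    normc (u n x - g x) <= e.
  move=> e0; have [N uN] := uc _ e0; exists N => n x Nn.
  rewrite -lecR -normr_normc; apply/ler_addgt0Pr => d d0.
  have [k [/= Nk gk]] : exists k : nat, (N <= k)%N /\ `|g x - u k x| <= d.
    apply: (@filter_ex _ \oo); apply: filterI; first by exists N.
    by move/cvgrPdist_le: (ux x); exact.
  rewrite (_ : u n x - g x = (u n x - u k x) + (u k x - g x)); last by ring.
  apply: le_trans (ler_normD _ _) _; rewrite lerD//; last by rewrite distrC.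
  rewrite normr_normc lecR; apply: le_trans (ltW (uN n k Nn Nk)).
  exact: (cfun_norm_ge (u n - u k)).
have gc : continuous g.
  move=> x; apply/(@cvgrPdist_le _ _ _ _ (nbhs_filter x)) => e e0.
  have e3 : 0 < complex.Re e / 3 by rewrite divr_gt0// -ltcR -gt0_RRe.
  have [N /(_ N _ (leqnn _)) uN] := ug _ e3.
  have e3' : 0 < (complex.Re e / 3)%:C by rewrite ltcR.
  have /(@cvgrPdist_le _ _ _ _ (nbhs_filter x))/(_ _ e3') :=
    @cts_fun _ _ (u N) x.
  apply: filterS => y uxy; rewrite (gt0_RRe e0).
  rewrite (_ : g x - g y =
    - (u N x - g x) + ((u N x - u N y) + (u N y - g y))); last by ring.
  apply: le_trans (ler_normD _ _) _.
  rewrite (_ : complex.Re e = complex.Re e / 3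
    + (complex.Re e / 3 + complex.Re e / 3)); last by field.
  rewrite !rmorphD/= lerD//; first by rewrite normrN normr_normc lecR.
  by apply: le_trans (ler_normD _ _) _; rewrite lerD// normr_normc lecR.
exists (mkcts gc) => e e0; have [|N uN] := ug (e / 2); first by rewrite divr_gt0.
exists N => n Nn; apply: (@le_lt_trans _ _ (e / 2)).
  by apply: cfun_norm_le => x; exact: uN.
by rewrite ltr_pdivrMr// ltr_pMr// ltr1n.
Qed.

Fact cfun_starK : involutive cfun_star.
Proof. by move=> f; apply: cfunP => x /=; exact: conjcK. Qed.
Fact cfun_starD : {morph cfun_star : f g / f + g}.
Proof. by move=> f g; apply: cfunP => x /=; exact: rmorphD. Qed.
Fact cfun_starZ z f : cfun_star (z *: f) = z^* *: cfun_star f.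
Proof. by apply: cfunP => x /=; exact: rmorphM. Qed.
Fact cfun_starM f g : cfun_star (f * g) = cfun_star g * cfun_star f.
Proof. by rewrite mulrC; apply: cfunP => x /=; exact: rmorphM. Qed.
Fact cfun_normM f g : cfun_norm (f * g) <= cfun_norm f * cfun_norm g.
Proof.
apply: cfun_norm_le => x.
by rewrite cfunME normcM ler_pM ?normc_ge0// cfun_norm_ge.
Qed.
Fact cfun_norm_star f : cfun_norm (cfun_star f * f) = cfun_norm f ^+ 2.
Proof.
have sE x : normc ((cfun_star f * f) x) = normc (f x) ^+ 2.
  by rewrite cfunME normcM expr2; congr (_ * _); exact: normc_conj.
apply/eqP; rewrite eq_le; apply/andP; split.
  apply: cfun_norm_le => x.
  by rewrite sE lerXn2r ?nnegrE ?normc_ge0 ?cfun_norm_ge0// cfun_norm_ge.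
have s0 := cfun_norm_ge0 (cfun_star f * f).
rewrite -[leRHS]sqr_sqrtr// lerXn2r ?nnegrE ?sqrtr_ge0 ?cfun_norm_ge0//.
apply: cfun_norm_le => x; rewrite -[leLHS]ger0_norm ?normc_ge0//.
by rewrite -sqrtr_sqr ler_wsqrtr// -sE cfun_norm_ge.
Qed.

HB.instance Definition _ := isCStarAlgebra.Build R (cfun R X)
  cfun_starK cfun_starD cfun_starZ cfun_starM cfun_normD cfun_normZ
  cfun_norm_eq0 cfun_normM cfun_norm_star cfun_complete.

Lemma cfun_starE f x : star f x = (f x)^*. Proof. by []. Qed.
Lemma cfun_cnormE f : cnorm f = sup [set normc (f x) | x in [set: X]].
Proof. by []. Qed.

End ContinuousFunctions.

Section Morphisms.
Context {R : realType}.

Definition cstar_embedding (A B : cstarAlgType R) (h : {lrmorphism A -> B}) :=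
  {morph h : a / star a} /\ (forall a, cnorm (h a) = cnorm a).

Definition cstar_isomorphic (A B : cstarAlgType R) :=
  exists2 h : {lrmorphism A -> B}, cstar_embedding h & bijective h.

(* T_conn enters only through its models: the C*-algebras isomorphic to C(X)
   for some continuum X. *)
Definition model_Tconn (A : cstarAlgType R) :=
  exists X : continuumType, cstar_isomorphic A (cfun R X).

End Morphisms.

Inductive cstar_term (R : realType) (V : Type) : Type :=
| TVar of V
| TZero
| TOne
| TAdd of cstar_term R V & cstar_term R V
| TScale of R[i] & cstar_term R V
| TMul of cstar_term R V & cstar_term R V
| TStar of cstar_term R V.

(* The metric needs no atomic formula of its own: d(s, t) is the norm of the
   term [s - t]. Connectives are all continuous functions from R^k to R. *)
Inductive qf_formula (R : realType) (V : Type) : Type :=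
| QFNorm of cstar_term R V
| QFConnective (k : nat) (u : 'rV[R]_k -> R) of
    continuous u & ('I_k -> qf_formula R V).

Section Semantics.
Context {R : realType} {A : cstarAlgType R} {V : Type}.

Fixpoint eval_term (v : V -> A) (t : cstar_term R V) : A :=
  match t with
  | TVar x => v x
  | TZero => 0
  | TOne => 1
  | TAdd s t => eval_term v s + eval_term v t
  | TScale z t => z *: eval_term v t
  | TMul s t => eval_term v s * eval_term v t
  | TStar t => star (eval_term v t)
  end.

Fixpoint eval_qf (v : V -> A) (phi : qf_formula R V) : R :=
  match phi with
  | QFNorm t => cnorm (eval_term v t)
  | QFConnective k u _ psi => u (\row_(i < k) eval_qf v (psi i))
  end.

End Semantics.

Definition valuation2 (A : Type) (m n : nat) (a : 'I_m -> A) (b : 'I_n -> A)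
    (v : 'I_m + 'I_n) : A :=
  match v with inl i => a i | inr j => b j end.

(* The value at [b] of inf_x phi(x, y). In continuous logic every quantifier is
   bounded: the i-th quantified variable ranges over the closed ball of radius
   [r i] around 0, and these balls are the domains of quantification of the
   language of C*-algebras. *)
Definition qf_inf (R : realType) (A : cstarAlgType R) (m n : nat)
    (r : 'I_m -> nat) (phi : qf_formula R ('I_m + 'I_n)) (b : 'I_n -> A)
    : \bar R :=
  ereal_inf [set (eval_qf (valuation2 a b) phi)%:E | a in
    [set a : 'I_m -> A | forall i, cnorm (a i) <= (r i)%:R]].

(* The inclusion M <= N is given by an embedding [h]. *)
Definition existentially_closed (R : realType) (M : cstarAlgType R) :=
  model_Tconn M /\
  forall (N : cstarAlgType R) (h : {lrmorphism M -> N}),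
    model_Tconn N -> cstar_embedding h ->
    forall (m n : nat) (r : 'I_m -> nat) (phi : qf_formula R ('I_m + 'I_n))
           (b : 'I_n -> M),
      qf_inf r phi b = qf_inf r phi (h \o b).

Definition coexistentially_closed (R : realType) (X : continuumType) :=
  existentially_closed (cfun R X).

Definition approx_alg_closed (R : realType) (A : cstarAlgType R) :=
  forall (n : nat) (a : 'I_n -> A) (eps : R), (0 < n)%N -> 0 < eps ->
    exists f : A, cnorm (\sum_(i < n) a i * f ^+ i + f ^+ n) < eps.

(* Main.v *)
(* Write [P_x(z)] for the polynomial [sum_i a_i(x) z^i + z^n]. Its roots form a
   compact space [Z] of pairs [(x, z)] in X * C with [P_x(z) = 0]. As
   [|P_x(z)|] is the product of the distances from [z] to the roots of [P_x],
   a root of [P_x] is close to a root of [P_y] for [y] near [x]: the projection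
   from Z to X is open. It is also closed, so it maps every nonempty clopen
   subset of Z onto the connected space X and, by compactness, every
   quasi-component Y of Z onto X. Quasi-components of compact Hausdorff spaces
   are connected, so Y is a continuum and C(X) embeds in C(Y), where the second
   coordinate is an exact root of the polynomial. Existential closedness then
   provides approximate roots in C(X). *)

Require Import Defs.
From HB Require Import structures.
From mathcomp Require Import all_boot all_order all_algebra.
From mathcomp Require Import all_classical all_reals ereal topology normedtype.
From mathcomp Require Import complex.
Set Implicit Arguments.
Unset Strict Implicit.
Unset Printing Implicit Defensive.
Import Order.TTheory GRing.Theory Num.Theory.
Import numFieldNormedType.Exports.
Local Open Scope classical_set_scope.
Local Open Scope ring_scope.
Local Open Scope complex_scope.
Import ComplexField.Normc.

(** * Compactness and subspaces *)

(** The traces of the members of [G] on [K] form a filter base, and a cluster point of it lies in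
    every closed [B]. *)
Lemma compact_bigcap_neq0 (T : topologicalType) (K : set T)
    (G : set (set T)) :
  compact K -> G !=set0 -> setI_closed G ->
  (forall B, G B -> closed B) -> (forall B, G B -> K `&` B !=set0) ->
  exists2 x, K x & forall B, G B -> B x.
Proof.
move=> Kc [B0 GB0] GI Gc GK.
have FF : ProperFilter (filter_from G (setI K)).
  apply: filter_from_proper => //.
  apply: filter_from_filter; first by exists B0.
  move=> B C GB GC; exists (B `&` C); first exact: GI.
  by move=> x [Kx [Bx Cx]].
have [|x [Kx clx]] := Kc _ FF; first by exists B0 => // x [].
exists x => // B GB; apply: (Gc _ GB) => U xU.
have [|y [[Ky By] Uy]] := clx (K `&` B) U _ xU; first by exists B.
by exists y.
Qed.

(** Serves to prove a space Hausdorff by means of continuous maps into Hausdorff spaces that jointly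
    separate its points. *)
Lemma cluster_continuous_eq (S T : topologicalType) (f : S -> T) (p q : S) :
  hausdorff_space T -> continuous f -> cluster (nbhs p) q -> f p = f q.
Proof.
move=> hT fc pq; apply: hT => A B /fc pA /fc qB.
by have [x [Ax Bx]] := pq _ _ pA qB; exists (f x).
Qed.

Section SetType.
Context {T : topologicalType} (A : set T).

Lemma set_val_continuous : continuous (set_val : A -> T).
Proof. exact: initial_continuous. Qed.

Lemma set_type_compact : compact A -> compact [set: A].
Proof.
move=> Ac F FF _.
have FA : (set_val @ F) A.
  by apply: (@filterS _ F _ setT) filterT => x _; exact: set_valP.
have [a [Aa aF]] := Ac (set_val @ F) _ FA.
exists (exist _ a (mem_set Aa)); split => // B U FB [_ [[V Vo <-] Va VU]].
have [|x [[y By <-] Vy]] := aF (set_val @` B) V _ (open_nbhs_nbhs (conj Vo Va)).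
  by apply: (@filterS _ F _ B) FB => y By; exists y.
by exists y; split => //; exact: VU.
Qed.

Lemma set_type_connected : connected A -> connected [set: A].
Proof.
move=> Ac B [b Bb] [_ [O Oo <-]]; rewrite setTI => BO [C Cc].
rewrite setTI => BC.
(* The complement of [O'] will show that the image of [B] is closed in [A]. *)
have [O' Oo' CO'] : exists2 O', open O' & ~` B = set_val @^-1` O'.
  by move: Cc => /closed_openC; rewrite BC => -[O' ? <-]; exists O'.
have sBA : set_val @` B = A.
  apply: Ac; first by exists (set_val b), b.
    exists O => //; apply/seteqP; split => [_ [x Bx <-]|x [Ax Ox]].
      by split; [exact: set_valP|move: Bx; rewrite BO].
    by exists (exist _ x (mem_set Ax)) => //; rewrite BO.
  exists (~` O'); first exact: open_closedC.
  apply/seteqP; split => [_ [x Bx <-]|x [Ax Ox]].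
    split; [exact: set_valP|move=> O'x].
    have : (~` B) x by rewrite CO'.
    exact.
  exists (exist _ x (mem_set Ax)) => //; apply: contrapT => nBx.
  have : (~` B) (exist _ x (mem_set Ax)) by [].
  by rewrite CO'.
apply/seteqP; split => // x _.
have : A (set_val x) by exact: set_valP.
by rewrite -{1}sBA => -[y By /val_inj <-].
Qed.

End SetType.

(* In a compact Hausdorff space this is also the connected component of [p]. *)
Definition quasi_component (T : topologicalType) (p : T) : set T :=
  \bigcap_(A in [set A | clopen A /\ A p]) A.

(** * Quasi-components of compact spaces *)

Section QuasiComponent.
Context {T : topologicalType} (Tc : compact [set: T]).
Implicit Types (A U : set T) (p : T).

Lemma quasi_component_refl p : quasi_component p p.
Proof. by move=> A []. Qed.

Lemma closed_quasi_component p : closed (quasi_component p).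
Proof. by apply: closed_bigI => A [[]]. Qed.

(** Otherwise every clopen set around [p] meets the compact complement of [U]. These clopen sets are
    closed under intersection, so some point outside [U] lies in all of them, hence in the
    quasi-component. *)
Lemma quasi_component_sub_open p U : open U -> quasi_component p `<=` U ->
  exists2 A, clopen A /\ A p & A `<=` U.
Proof.
move=> Uo pU; apply: contrapT => noA.
have [|||A [[]]//|A [Ac Ap]|x nUx xp] := @compact_bigcap_neq0 T (~` U)
    [set A | clopen A /\ A p].
- exact: (subclosed_compact (open_closedC Uo) Tc).
- by exists setT; split=> //; exact: clopenT.
- by move=> A B [? ?] [? ?]; split => //; exact: clopenI.
- apply: contrapT => AU; apply: noA; exists A => // x Ax.
  by apply: contrapT => Ux; apply: AU; exists x.
- by apply: nUx; apply: pU => A /xp.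
Qed.

(** Normality separates [B] and [Q \ B] by disjoint open sets [U] and [V], and some clopen [A]
    around [p] lies in their union. The one of [U] and [V] that contains [p] cuts [A] in a clopen
    set, so it contains all of [Q]. *)
Lemma quasi_component_connected p : hausdorff_space T ->
  connected (quasi_component p).
Proof.
move=> Th B [b Bb] [C Co BC] [D Dc BD].
set Q := quasi_component p in BC BD *.
have QBC : Q `\` B = Q `&` ~` C.
  rewrite BC; apply/seteqP; split => x [Qx nx]; split => //.
    by move=> Cx; apply: nx.
  by move=> [_].
have Bcl : closed B.
  by rewrite BD; apply: closedI => //; exact: closed_quasi_component.
have QBcl : closed (Q `\` B).
  rewrite QBC; apply: closedI; first exact: closed_quasi_component.
  exact: open_closedC.
have [U [V [Uo Vo BU QV disj]]] : exists U V : set T,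
    [/\ open U, open V, B `<=` U, Q `\` B `<=` V & forall x, U x -> ~ V x].
  have [|W /set_nbhsP[U [Uo BU UW]] WQB] :=
      compact_normal Th Tc Bcl (_ : set_nbhs B (~` (Q `\` B))).
    apply/set_nbhsP; exists (~` (Q `\` B)); split => //.
      exact: closed_openC.
    by move=> x Bx [].
  exists U, (~` closure W); split => //.
  - exact/closed_openC/closed_closure.
  - by move=> x QBx Wx; exact: WQB QBx.
  - by move=> x /UW/subset_closure Wx; apply.
have [||A [[Ao Ac] Ap] AUV] := @quasi_component_sub_open p (U `|` V).
- exact: openU.
- move=> x Qx; have [Bx|Bx] := pselect (B x); first by left; exact: BU.
  by right; apply: QV.
(* Stated for arbitrary [U'] and [V'] because it is applied in both orders, according to the side on
   which [p] lies. *)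
have clU (U' V' : set T) : open U' -> open V' ->
    (forall x, U' x -> ~ V' x) -> A `<=` U' `|` V' -> U' p -> Q `<=` U'.
  move=> U'o V'o dj AU' U'p.
  have AE : A `&` U' = A `&` ~` V'.
    apply/seteqP; split => x [Ax ?]; split => //; first by move=> /dj; exact.
    by have [] := AU' _ Ax.
  suff h : clopen (A `&` U').
    by move=> x Qx; have [] := Qx _ (conj h (conj Ap U'p)).
  split; first exact: openI.
  by rewrite AE; apply: closedI => //; exact: open_closedC.
have BQ : B `<=` Q by rewrite BC => x [].
have [Bp|Bp] := pselect (B p).
  apply/seteqP; split => // x Qx; apply: contrapT => nBx.
  apply: (disj x); first by apply: (clU _ _ Uo Vo disj AUV (BU _ Bp)).
  by apply: QV.
have QV' : Q `<=` V.
  apply: (clU _ _ Vo Uo).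
  - by move=> x Vx Ux; exact: disj Ux Vx.
  - by rewrite setUC.
  - by apply: QV; split => //; exact: quasi_component_refl.
by exfalso; exact: disj (BU _ Bb) (QV' _ (BQ _ Bb)).
Qed.

(** A clopen [A] around [p] has an image that is nonempty, open and, by compactness, closed, so [A]
    meets the fibre over [x]. The fibre is compact, so one of its points lies in all such [A]. *)
Lemma quasi_component_surjective (X : topologicalType) (f : T -> X) p :
  hausdorff_space X -> connected [set: X] -> continuous f ->
  (forall U, open U -> open (f @` U)) ->
  f @` quasi_component p = [set: X].
Proof.
move=> Xh Xc fc fo; apply/seteqP; split => // x _.
have [|||A [[]]//|A [[Ao Ac] Ap]|y fy yp] :=
    @compact_bigcap_neq0 T (f @^-1` [set x]) [set A | clopen A /\ A p].
- apply: (subclosed_compact _ Tc) => //.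
  move/continuous_closedP: fc; apply.
  by apply: compact_closed => //; exact: compact_set1.
- by exists setT; split=> //; exact: clopenT.
- by move=> A B [? ?] [? ?]; split => //; exact: clopenI.
- have : f @` A = setT.
    apply: Xc; first by exists (f p), p.
      by exists (f @` A); [exact: fo|rewrite setTI].
    exists (f @` A); last by rewrite setTI.
    apply: compact_closed => //; apply: continuous_compact.
      exact: continuous_subspaceT.
    exact: (subclosed_compact Ac Tc).
  move/seteqP => [_ /(_ x I)] [y Ay fy]; by exists y.
- by exists y => // A /yp.
Qed.

End QuasiComponent.

(** * Roots of monic polynomials *)

(** The ring is arbitrary because evaluation takes place both in the complex numbers, point by
    point, and in C*-algebras. *)
Definition monic_eval (F : pzRingType) (n : nat) (c : 'I_n -> F) (z : F) :=
  \sum_(i < n) c i * z ^+ i + z ^+ n.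

Section MonicPolynomials.
Context {F : numClosedFieldType} {n : nat}.
Implicit Types (c : 'I_n -> F) (z w : F).

Lemma monic_eval_factor c :
  exists2 s : seq F, size s = n &
    forall z, monic_eval c z = \prod_(w <- s) (z - w).
Proof.
pose q : {poly F} := \sum_(i < n) c i *: 'X^i.
pose p := 'X^n + q.
have qn : (size q <= n)%N.
  apply: (leq_trans (size_sum _ _ _)); apply/bigmax_leqP => i _.
  by apply: leq_trans (size_scale_leq _ _) _; rewrite size_polyXn.
have pn : size p = n.+1 by rewrite size_polyDl size_polyXn.
have pm : lead_coef p = 1 by rewrite lead_coefDl ?size_polyXn// lead_coefXn.
have [s] := closed_field_poly_normal p; rewrite pm scale1r => ps.
exists s.
  by apply/eqP; rewrite -eqSS -pn ps size_prod_XsubC.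
move=> z; have : p.[z] = monic_eval c z.
  rewrite hornerD hornerXn horner_sum addrC; congr (_ + _).
  by apply: eq_bigr => i _; rewrite hornerZ hornerXn.
move=> <-; rewrite ps horner_prod; apply: eq_bigr => w _.
by rewrite hornerXsubC.
Qed.

(** If all [n] roots were at distance at least [d] from [z], the product of these distances would be
    at least [d ^+ n]. *)
Lemma monic_root_near c z (d : F) : 0 < d -> `|monic_eval c z| < d ^+ n ->
  exists2 w, monic_eval c w = 0 & `|z - w| < d.
Proof.
move=> d0; have [s sn sE] := monic_eval_factor c.
rewrite sE => sd.
have [w ws zw] : exists2 w, w \in s & `|z - w| < d.
  apply: contrapT => H; move: sd; apply/negP.
  have : forall w, w \in s -> d <= `|z - w|.
    move=> w ws; rewrite real_leNgt ?normr_real ?gtr0_real//.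
    by apply/negP => zw; apply: H; exists w.
    rewrite -sn -real_leNgt ?normr_real ?ger0_real ?exprn_ge0 ?(ltW d0)//.
  elim: {sn sE H} s => [|a s IH] h; first by rewrite big_nil normr1.
  rewrite big_cons normrM exprS ler_pM ?exprn_ge0 ?(ltW d0)//.
    by apply: h; rewrite mem_head.
  by apply: IH => w ws; apply: h; rewrite in_cons ws orbT.
exists w => //; rewrite sE; apply/eqP; rewrite prodf_seq_eq0; apply/hasP.
by exists w; rewrite //= subrr eqxx.
Qed.

(** The summand 1 covers [|z| <= 1]. Otherwise dividing the equation for the leading power by
    [|z| ^+ (n - 1)] leaves at most the sum of the [|c i|]. *)
Lemma monic_root_norm_le c z : monic_eval c z = 0 ->
  `|z| <= 1 + \sum_(i < n) `|c i|.
Proof.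
(* In degree 0 the polynomial is the constant 1, which has no root. *)
case: n c => [|m] c.
  by rewrite /monic_eval big_ord0 add0r expr0 => /eqP; rewrite oner_eq0.
move=> /eqP; rewrite /monic_eval addr_eq0 => /eqP cz.
have [z1|z1] := real_leP (normr_real z) (@real1 F).
  by rewrite (le_trans z1)// lerDl sumr_ge0.
apply: (@le_trans _ _ (\sum_(i < m.+1) `|c i|)); last by rewrite lerDr.
have zm : 0 < `|z| ^+ m by rewrite exprn_gt0// (lt_trans _ z1).
rewrite -(ler_pM2r zm) -exprS -normrX -normrN -cz mulr_suml.
apply: le_trans (ler_norm_sum _ _ _) _; apply: ler_sum => i _.
rewrite normrM ler_wpM2l// normrX ler_weXn2l ?ltW//.
by rewrite -ltnS.
Qed.

End MonicPolynomials.

(** * Compact discs in the complex plane *)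

Section ComplexTopology.
Context {R : realType}.

Lemma complex_pair_continuous :
  continuous (fun p : R * R => p.1 +i* p.2 : R[i]).
Proof.
move=> [a b]; apply/cvgrPdist_lt => e e0; rewrite (gt0_RRe e0).
have e2 : 0 < complex.Re e / 2 by rewrite divr_gt0// -ltcR -gt0_RRe.
have /cvgrPdist_lt/(_ _ e2) fa : fst @ nbhs (a, b) --> a by exact: cvg_fst.
have /cvgrPdist_lt/(_ _ e2) fb : snd @ nbhs (a, b) --> b by exact: cvg_snd.
apply: filterS2 fa fb => p pa pb.
apply: le_lt_trans (normc_le_ReIm _) _.
by rewrite ltcR !raddfB/= [ltRHS]splitr ltrD.
Qed.

(** The disc is a closed subset of the continuous image of a compact real square. *)
Lemma complex_disc_compact (M : R) : compact [set z : R[i] | `|z| <= M%:C].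
Proof.
pose sq := `[- M, M]%classic `*` `[- M, M]%classic : set (R * R).
have sqc : compact ((fun p : R * R => p.1 +i* p.2 : R[i]) @` sq).
  apply: continuous_compact.
    exact/continuous_subspaceT/complex_pair_continuous.
  by apply: compact_setX; exact: segment_compact.
apply: subclosed_compact sqc _.
  rewrite (_ : [set z | _] = @normc R @^-1` [set x | x <= M]).
    move/continuous_closedP: (@normc_continuous R); apply.
    exact: closed_le.
  by apply/seteqP; split => z /=; rewrite normr_normc lecR.
move=> [a b] /= ab; exists (a, b) => //.
have h := le_trans (normc_ge_Re (a +i* b)) ab.
split; rewrite /= in_itv/= -ler_norml -lecR//.
(* The imaginary part is, up to sign, the real part after multiplication by ['i]. *)
apply: le_trans ab; rewrite -normrN.
have := normc_ge_Re ((a +i* b) * 'i%C).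
by rewrite normrM normc_i mulr1/= mulr0 mulr1 sub0r.
Qed.

End ComplexTopology.

(** * The space of roots over X *)

Section RootSpace.
Context {R : realType} {X : continuumType} {n : nat} (a : 'I_n -> cfun R X).
Implicit Types (x : X) (z : R[i]).

Definition root_set : set (X * R[i]) :=
  [set p | monic_eval (fun i => a i p.1) p.2 = 0].

Lemma monic_eval_continuous :
  continuous (fun p : X * R[i] => monic_eval (fun i => a i p.1) p.2).
Proof.
have expc k : continuous (fun p : X * R[i] => p.2 ^+ k).
  elim: k => [|k IH]; first by move=> p; exact: cvg_cst.
  under eq_fun do rewrite exprS.
  by move=> p; apply: cvgM; [exact: cvg_snd|exact: IH].
have sumc : continuous (fun p : X * R[i] => \sum_(i < n) a i p.1 * p.2 ^+ i).
  apply: (continuous_big (@add_continuous R[i])) => i _ p.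
  apply: cvgM; last exact: expc.
  by apply: continuous_comp; [exact: cvg_fst|exact: cts_fun].
by move=> p; apply: cvgD; [exact: sumc|exact: expc].
Qed.

Lemma root_set_closed : closed root_set.
Proof.
move/continuous_closedP: monic_eval_continuous => /(_ [set 0]); apply.
by apply: compact_closed; [exact: norm_hausdorff|exact: compact_set1].
Qed.

Lemma root_set_compact : compact root_set.
Proof.
(* This bounds the roots over all points at once, since [|a i x|] is at most the norm of [a i]. *)
pose M : R := 1 + \sum_(i < n) cnorm (a i).
have := compact_setX (@continuum_compact X) (@complex_disc_compact R M).
move=> /(subclosed_compact root_set_closed); apply.
move=> [x z] /monic_root_norm_le /= h; split => //=.
apply: le_trans h _; rewrite rmorphD rmorph_sum/= lerD//.
by apply: ler_sum => i _; rewrite normr_normc lecR; exact: cfun_norm_ge.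
Qed.

Definition root_proj (p : root_set) : X := (set_val p).1.

Lemma root_proj_continuous : continuous root_proj.
Proof.
move=> p; apply: continuous_comp; first exact: set_val_continuous.
exact: cvg_fst.
Qed.

(** Let [z] be a root over [x]. With [z] fixed, the value of the polynomial over [y] tends to 0 as
    [y] tends to [x]; once it is below [d ^+ n] in modulus, there is a root over [y] within [d] of
    [z]. *)
Lemma root_proj_open (U : set root_set) : open U -> open (root_proj @` U).
Proof.
move=> [O Oo <-]; rewrite openE => _ [[[x z] Z] /= Oxz <-].
have Zxz : root_set (x, z) := set_mem Z.
rewrite /root_proj /interior/=.
have [[N D] /= [Nx Dz] ND] : nbhs (x, z) O by exact: open_nbhs_nbhs.
have [d /= d0 dD] : exists2 d, 0 < d & ball z d `<=` D.
  by move/nbhs_ballP: Dz => -[d]; exists d.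
have dn0 : 0 < d ^+ n by rewrite exprn_gt0.
have ce : (fun y => monic_eval (fun i => a i y) z) @ x --> (0 : R[i]).
  rewrite -[X in _ --> X]Zxz.
  apply: (@continuous_comp _ _ _ (fun y => (y, z))
    (fun p : X * R[i] => monic_eval (fun i => a i p.1) p.2)).
    exact: (@cvg_pair _ _ _ _ (nbhs x) (nbhs z) _ _ _ id _ cvg_id (cvg_cst z)).
  exact: monic_eval_continuous.
move/cvgrPdist_lt/(_ _ dn0) : ce => ce.
apply: filterS2 Nx ce => y Ny; rewrite sub0r normrN => yd.
have [w yw zw] := monic_root_near d0 yd.
exists (exist _ (y, w) (mem_set yw)) => //=.
by apply: ND; split => //=; apply: dD; rewrite -ball_normE.
Qed.

Lemma root_set_hausdorff : hausdorff_space root_set.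
Proof.
move=> p q pq; apply: val_inj; apply: injective_projections.
  exact: cluster_continuous_eq continuum_hausdorff root_proj_continuous pq.
have zc : continuous (snd \o set_val : root_set -> R[i]).
  move=> r; apply: continuous_comp; first exact: set_val_continuous.
  exact: cvg_snd.
exact: cluster_continuous_eq (@norm_hausdorff _ R[i]) zc pq.
Qed.

Lemma root_set_nonempty : (0 < n)%N -> root_set !=set0.
Proof.
move=> n0; have [x _] := @continuum_nonempty X.
have [[|w s] sn sE] := monic_eval_factor (fun i => a i x).
  by rewrite -sn in n0.
by exists (x, w); rewrite /root_set/= sE big_cons subrr mul0r.
Qed.

Lemma exists_root_cover : (0 < n)%N ->
  exists (Y : continuumType) (pi : continuousType Y X) (g : cfun R Y),
    range pi = [set: X] /\
    forall y, monic_eval (fun i => a i (pi y)) (g y) = 0.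
Proof.
move=> /root_set_nonempty[p0 Zp0].
pose p : root_set := exist _ p0 (mem_set Zp0).
have Zc := set_type_compact root_set_compact.
(* The base point is arbitrary, as every quasi-component maps onto [X]. *)
pose Q := quasi_component p.
have Qne : [set: Q] !=set0.
  by exists (exist _ p (mem_set (@quasi_component_refl _ p))).
have Qh : hausdorff_space Q.
  move=> q r qr; apply: val_inj.
  exact: cluster_continuous_eq root_set_hausdorff (@set_val_continuous _ _) qr.
have Qc : compact [set: Q].
  apply: set_type_compact.
  exact: (subclosed_compact (@closed_quasi_component _ p) Zc).
have Qconn : connected [set: Q].
  apply: set_type_connected; apply: quasi_component_connected => //.
  exact: root_set_hausdorff.
pose mix := isContinuum.Build (set_type Q) Qne Qh Qc Qconn.
pose Y : continuumType := HB.pack (set_type Q) mix.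
have pic : continuous (root_proj \o set_val : Y -> X).
  move=> q; apply: continuous_comp; first exact: set_val_continuous.
  exact: root_proj_continuous.
have gc : continuous (snd \o (set_val \o set_val) : Y -> R[i]).
  move=> q; apply: continuous_comp; last exact: cvg_snd.
  by apply: continuous_comp; exact: set_val_continuous.
exists Y, (mkcts pic), (mkcts gc); split.
  rewrite -(quasi_component_surjective Zc p continuum_hausdorff
    continuum_connected root_proj_continuous root_proj_open).
  apply/seteqP; split => [_ [q _ <-]|_ [q Qq <-]].
    by exists (set_val q) => //; exact: set_valP.
  by exists (exist _ q (mem_set Qq)).
by move=> y; exact: (set_valP (set_val y)).
Qed.

End RootSpace.

(** * Embedding C(X) into C(Y) *)

Fact pullback_subproof (R : realType) (X Y : continuumType)
  (pi : continuousType Y X) (f : cfun R X) : continuous (f \o pi).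
Proof. by move=> y; apply: continuous_comp; exact: cts_fun. Qed.

Definition pullback (R : realType) (X Y : continuumType)
    (pi : continuousType Y X) (f : cfun R X) : cfun R Y :=
  mkcts (@pullback_subproof R X Y pi f).

Section Pullback.
Context {R : realType} {X Y : continuumType} (pi : continuousType Y X).

Fact pullback_is_additive : additive (@pullback R X Y pi).
Proof. by move=> f g; apply: cfunP. Qed.
HB.instance Definition _ := GRing.isAdditive.Build (cfun R X) (cfun R Y)
  (pullback pi) pullback_is_additive.

Fact pullback_is_monoid_morphism : monoid_morphism (@pullback R X Y pi).
Proof. by split => [|f g]; apply: cfunP. Qed.
HB.instance Definition _ :=
  GRing.isMonoidMorphism.Build (cfun R X) (cfun R Y)
  (pullback pi) pullback_is_monoid_morphism.

Fact pullback_is_scalable : scalable (@pullback R X Y pi).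
Proof. by move=> z f; apply: cfunP. Qed.
HB.instance Definition _ := GRing.isScalable.Build R[i] (cfun R X) (cfun R Y)
  *:%R (pullback pi) pullback_is_scalable.

(** Surjectivity makes [f] and [f \o pi] take the same values, so their sup norms agree. *)
Lemma pullback_embedding : range pi = [set: X] ->
  cstar_embedding (@pullback R X Y pi : {lrmorphism cfun R X -> cfun R Y}).
Proof.
move=> piX; split => [f|f]; first exact: cfunP.
rewrite !cfun_cnormE; congr sup; apply/seteqP.
split => [_ [y _ <-]|_ [x _ <-]].
  by exists (pi y).
have : range pi x by rewrite piX.
by move=> [y _ <-]; exists y.
Qed.

End Pullback.

Lemma model_Tconn_cfun (R : realType) (X : continuumType) :
  model_Tconn (cfun R X).
Proof. by exists X; exists idfun => //; exists idfun. Qed.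

(** * The polynomial as a formula *)

Section MonicFormula.
Context {R : realType} {V : Type}.
Implicit Types t : cstar_term R V.

Definition TExp t k := iter k (TMul t) (TOne R V).

Definition monic_term n (c : 'I_n -> cstar_term R V) t : cstar_term R V :=
  TAdd (\big[@TAdd R V/TZero R V]_(i < n) TMul (c i) (TExp t i)) (TExp t n).

Lemma eval_TExp (A : cstarAlgType R) (v : V -> A) t k :
  eval_term v (TExp t k) = eval_term v t ^+ k.
Proof. by elim: k => //= k ->; rewrite exprS. Qed.

Lemma eval_monic_term (A : cstarAlgType R) (v : V -> A) n
    (c : 'I_n -> cstar_term R V) t :
  eval_term v (monic_term c t) =
  monic_eval (eval_term v \o c) (eval_term v t).
Proof.
(* Terms form no monoid under [TAdd], but evaluation sends the fold of [TAdd] to a genuine sum. *)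
rewrite /= eval_TExp (big_morph (eval_term v) (id1 := 0) (op1 := +%R))//.
by congr (_ + _); apply: eq_bigr => i _; rewrite /= eval_TExp.
Qed.

End MonicFormula.

(** Evaluation at a point is a ring homomorphism; hence roots chosen continuously in the fibres
    amount to one root in the function algebra. *)
Lemma cfun_monic_evalE (R : realType) (X : continuumType) n
    (a : 'I_n -> cfun R X) (f : cfun R X) (x : X) :
  monic_eval a f x = monic_eval (fun i => a i x) (f x).
Proof.
have xX k : (f ^+ k) x = f x ^+ k.
  by elim: k => [|k IH]; [rewrite !expr0|rewrite !exprS cfunME IH].
rewrite cfunDE xX; congr (_ + _).
rewrite (big_morph (fun g : cfun R X => g x) (id1 := 0) (op1 := +%R))//.
by apply: eq_bigr => i _; rewrite cfunME xX.
Qed.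

Theorem theorem4p6 (R : realType) (X : continuumType) :
  coexistentially_closed R X -> approx_alg_closed (cfun R X).
Proof.
move=> [_ Xec] n a e n0 e0.
have [Y [pi [g [piX ag0]]]] := exists_root_cover a n0.
(* The quantifier is bounded, so its ball must be large enough to contain the exact root [g]. *)
pose r (_ : 'I_1) := Num.bound (cnorm g).
pose phi : qf_formula R ('I_1 + 'I_n) := QFNorm (monic_term
  (fun i => TVar R (inr i)) (TVar R (inl ord0))).
have phiE (A : cstarAlgType R) (v : 'I_1 + 'I_n -> A) :
    eval_qf v phi = cnorm (monic_eval (v \o inr) (v (inl ord0))).
  by rewrite -[LHS]/(cnorm (eval_term _ _)) eval_monic_term.
(* By existential closedness the infimum can be computed in C(Y), where [g] gives the value 0. *)
have : (qf_inf r phi a < e%:E)%E.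
  rewrite (Xec _ (pullback pi) (model_Tconn_cfun R Y) (pullback_embedding piX)).
  apply: (@le_lt_trans _ _ 0%E); last by rewrite lte_fin.
  apply: ereal_inf_lbound; exists (fun=> g).
    by move=> i /=; rewrite ltW// archi_boundP// cfun_norm_ge0.
  rewrite phiE (_ : monic_eval _ _ = 0).
    (* The norm of 0 vanishes by homogeneity. *)
    by rewrite -(scale0r 0) cnormZ normc0 mul0r.
  by apply: cfunP => y; rewrite cfun_monic_evalE; exact: ag0.
move=> /ereal_inf_lt[_ [f _ <-]].
by rewrite lte_fin phiE => fe; exists (f ord0).
Qed.
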